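(* Let $\mathbb{K}$ be an algebraically closed field, let $p$ be an odd positive integer and let $q\in\mathbb{K}\setminus\{0\}$ be not a root of unity. Let $A$ be the quantum torus with generators $z_1^{\pm1},\dots,z_p^{\pm 1}$ and relations $z_iz_j=q_{ij}z_jz_i$ for $1\leq j<i\leq p$, where $q_{ij}=q^{-1}$ if $i$ is even and $j$ is odd, and $q_{ij}=1$ otherwise. Let $\alpha$ be the $\mathbb{K}$-automorphism of $A$ with $\alpha(z_i)=z_i$ for $i$ even and $\alpha(z_i)=q^{-1}z_i$ for $i$ odd. Let $u=q^{\frac{p-1}{2}}z_p^{-1}+qz_p\in Z(A)$, let $v=u-\alpha(u)=(1-q)(q^{\frac{p-1}{2}}z_p^{-1}-z_p)$, let $R=R(A,\alpha,v,1)$ be the ambiskew polynomial ring and let $z=xy-u$ be its Casimir element. For $\lambda\in\mathbb{K}$, the ideal $(z-\lambda)R$ is maximal if and only if, for all $m\geq 1$, $\lambda\neq\pm q^{\frac{p-2m+1}{4}}(q^m+1)$.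
   Context: The ambiskew polynomial algebra $R(A,\alpha,v,1)$ ($v$ central in $A$) is the iterated skew polynomial ring $A[y;\alpha][x;\beta,\delta]$, where $\beta=\alpha^{-1}$ on $A$, $\beta(y)=y$, and $\delta$ is the $\beta$-derivation of $A[y;\alpha]$ with $\delta(A)=0$ and $\delta(y)=v$. Thus $ya=\alpha(a)y$ and $xa=\alpha^{-1}(a)x$ for all $a\in A$, and $xy=yx+v$. When $v=u-\alpha(u)$ with $u$ central in $A$, the Casimir element $z=xy-u$ is central in $R$. A fixed square root $q^{1/2}$ of $q$ in $\mathbb{K}$ is chosen; since $p$ is odd, $p-2m+1$ is even and $q^{\frac{p-2m+1}{4}}$ means $(q^{1/2})^{\frac{p-2m+1}{2}}$ (the pair $\pm q^{\frac{p-2m+1}{4}}(q^m+1)$ does not depend on the choice). *)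

(* Defs.v *)
From HB Require Import structures.
From mathcomp Require Import all_boot all_order all_algebra.

Set Implicit Arguments.
Unset Strict Implicit.
Unset Printing Implicit Defensive.

Import GRing.Theory.
Local Open Scope ring_scope.

(* The generators z_1^{+-1}, ..., z_p^{+-1} are given by two families z and zV
   indexed by nat, of which only the values at 1 <= i <= p are used; zV i is
   the inverse of z i, so that no unit-ring structure is needed. *)
Definition quantum_torus_relations (K : fieldType) (p : nat)
    (Q : nat -> nat -> K) (B : algType K) (z zV : nat -> B) : Prop :=
  (forall i, (1 <= i <= p)%N -> z i * zV i = 1 /\ zV i * z i = 1) /\
  (forall i j, (1 <= j)%N -> (j < i)%N -> (i <= p)%N ->
     z i * z j = Q i j *: (z j * z i)).

(* A is the K-algebra presented by the generators and relations above, in the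
   form of the universal property of the presentation. *)
Definition is_quantum_torus (K : fieldType) (p : nat) (Q : nat -> nat -> K)
    (A : algType K) (z zV : nat -> A) : Prop :=
  [/\ quantum_torus_relations p Q z zV,
      forall (B : algType K) (b bV : nat -> B),
        quantum_torus_relations p Q b bV ->
        exists f : {lrmorphism A -> B},
          forall i, (1 <= i <= p)%N -> f (z i) = b i /\ f (zV i) = bV i
    & forall (B : algType K) (f g : {lrmorphism A -> B}),
        (forall i, (1 <= i <= p)%N -> f (z i) = g (z i) /\ f (zV i) = g (zV i)) ->
        f =1 g].

Definition skew_derivation (B : nzRingType) (sigma delta : B -> B) : Prop :=
  forall a b, delta (a * b) = sigma a * delta b + delta a * b.

(* S = B[t; sigma, delta]: S contains B (through iota), it is a free left
   B-module on the powers of t, and t b = sigma(b) t + delta(b).  Note that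
   (map_poly iota P).[t] is \sum_i iota P`_i * t ^+ i, with the coefficients on
   the left, also when the rings are not commutative. *)
Definition is_skew_poly_ring (B S : nzRingType) (iota : {rmorphism B -> S})
    (t : S) (sigma delta : B -> B) : Prop :=
  (forall b, t * iota b = iota (sigma b) * t + iota (delta b)) /\
  (forall s, exists! P : {poly B}, s = (map_poly iota P).[t]).

(* R = R(A, alpha, v, 1) = A[y; alpha][x; beta, delta]; alphaV stands for the
   inverse of alpha, S for A[y; alpha], with y = jR yS, and iota is the
   inclusion of A in R. *)
Definition is_ambiskew_poly_ring (K : fieldType) (A R : algType K)
    (alpha alphaV : {lrmorphism A -> A}) (v : A)
    (iota : {lrmorphism A -> R}) (y x : R) : Prop :=
  exists (S : algType K) (iS : {lrmorphism A -> S}) (jR : {lrmorphism S -> R})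
    (yS : S) (beta : {lrmorphism S -> S}) (delta : {linear S -> S}),
  [/\ [/\ is_skew_poly_ring iS yS alpha (fun=> 0),
          is_skew_poly_ring jR x beta delta,
          forall a, iota a = jR (iS a)
        & y = jR yS],
      [/\ bijective beta, forall a, beta (iS a) = iS (alphaV a) & beta yS = yS]
    & [/\ skew_derivation beta delta, forall a, delta (iS a) = 0
        & delta yS = iS v]].

Definition two_sided_ideal (R : nzRingType) (I : R -> Prop) : Prop :=
  [/\ I 0, forall a b, I a -> I b -> I (a + b)
    & forall r a, I a -> I (r * a) /\ I (a * r)].

Definition maximal_ideal (R : nzRingType) (I : R -> Prop) : Prop :=
  [/\ two_sided_ideal I, ~ I 1
    & forall J : R -> Prop, two_sided_ideal J -> (forall r, I r -> J r) ->
        (forall r, J r -> I r) \/ (forall r, J r)].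

Definition principal_right (R : nzRingType) (c : R) : R -> Prop :=
  fun r => exists s, r = c * s.

Definition torus_coef (K : fieldType) (q : K) (i j : nat) : K :=
  if ~~ odd i && odd j then q^-1 else 1.

Definition torus_u (K : fieldType) (p : nat) (q : K) (A : algType K)
    (z zV : nat -> A) : A :=
  q ^+ (p.-1)./2 *: zV p + q *: z p.

(* Main.v *)
(* Modulo z - lambda, R becomes a generalized Weyl algebra with x y = w and
   y x = alpha(w), where w = u + lambda is a Laurent polynomial in the central
   element z_p.

   If w and alpha^m(w) have a common root, specialize z_p to it: R then acts on
   m copies of A by shift matrices X and Y, with Y^m = 0, and the kernel of this
   action is a proper ideal that contains y^m, which z - lambda does not divide.

   Otherwise, let J be an ideal that properly contains (z - lambda). Conjugation
   by z_p separates the powers of y and x, so J contains a nonzero a y^n or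
   a x^n. Conjugating by the other z_i, and comparing left and right
   multiplication by y (resp. x), shortens a to a monomial, which is a unit, so
   J contains a power y^n. As x y^n = w y^(n-1) and
   y^n x = alpha^n(w) y^(n-1), and w and alpha^n(w) are comaximal, J contains
   y^(n-1), and eventually 1. *)
Require Import Defs.
From HB Require Import structures.
From mathcomp Require Import all_boot all_order all_algebra.
From mathcomp Require Import boolp ring zify.

Set Implicit Arguments.
Unset Strict Implicit.
Unset Printing Implicit Defensive.

Import GRing.Theory.
Local Open Scope ring_scope.

(** * Skew polynomial rings *)

Lemma map_poly0_id (B C : nzRingType) (f : B -> C) :
  f 0 = 0 -> map_poly f 0 = 0.
Proof. by move=> f0; apply/polyP=> i; rewrite coef_map_id0 // !coef0. Qed.

Lemma map_poly_MXaddC (B C : nzRingType) (f : B -> C) (P : {poly B}) (c : B) :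
  f 0 = 0 ->
  map_poly f (P * 'X + c%:P) = map_poly f P * 'X + (f c)%:P.
Proof.
move=> f0; apply/polyP => i.
rewrite coef_map_id0 // !(coefD, coefMX, coefC) coef_map_id0 //.
by case: i => [|i]; rewrite ?(add0r, addr0).
Qed.

Section SkewPolynomials.
Context (B S : nzRingType) (iota : {rmorphism B -> S}) (t : S).
Context (sigma delta : B -> B).
Hypotheses (sigma0 : sigma 0 = 0) (delta0 : delta 0 = 0).
Hypothesis (skewS : is_skew_poly_ring iota t sigma delta).

Definition skew_mulX (P : {poly B}) := map_poly sigma P * 'X + map_poly delta P.

(** [skew_mulX] is left multiplication by the variable, read on coefficients. The target ring and
    [T] are arbitrary so that the same computation serves [S] itself and the morphisms out of
    [S]. *)
Lemma skew_mulXE (E : nzRingType) (phi : {rmorphism B -> E}) (T : E)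
    (P : {poly B}) :
  (forall b, T * phi b = phi (sigma b) * T + phi (delta b)) ->
  T * (map_poly phi P).[T] = (map_poly phi (skew_mulX P)).[T].
Proof.
move=> comm; rewrite /skew_mulX; elim/poly_ind: P => [|P c IH].
  rewrite [map_poly phi 0]rmorph0 horner0 mulr0.
  by rewrite !map_poly0_id // mul0r addr0 rmorph0 horner0.
rewrite !map_poly_MXaddC ?rmorph0 // hornerMXaddC mulrDr mulrA IH comm.
move: (map_poly sigma P) (map_poly delta P) => s d.
rewrite !(rmorphD, rmorphM) /= !map_polyX !map_polyC /=.
rewrite !(hornerD, hornerMX, hornerC) mulrDl !addrA; congr (_ + _).
by rewrite mulrDl -!addrA; congr (_ + _); rewrite addrC.
Qed.

Lemma skew_horner_inj (P Q : {poly B}) :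
  (map_poly iota P).[t] = (map_poly iota Q).[t] -> P = Q.
Proof.
move=> PQ; have [W [_ uniqW]] := skewS.2 (map_poly iota P).[t].
by rewrite -(uniqW P erefl) -(uniqW Q PQ).
Qed.

(** As [delta] vanishes, coefficient [i.+1] of [t * s] is [sigma] of coefficient [i] of [s]. *)
Lemma skew_poly_mul0 (s : S) : injective sigma -> delta =1 (fun=> 0) ->
  t * s = 0 -> s = 0.
Proof.
move=> sigma_inj d0; have [P [-> _]] := skewS.2 s.
rewrite (skew_mulXE _ skewS.1) => ts0.
have /polyP P0 : skew_mulX P = 0.
  by apply: skew_horner_inj; rewrite ts0 rmorph0 horner0.
suff -> : P = 0 by rewrite rmorph0 horner0.
apply/polyP=> i; apply: sigma_inj; move: (P0 i.+1).
by rewrite !coef0 sigma0 coefD coefMX /= !coef_map_id0 // d0 addr0.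
Qed.

(** The product has degree one more than [s], with leading coefficient [c] times [sigma] of that of
    [s]. This is nonzero by regularity of [c], whereas [iota b] has degree zero. *)
Lemma skew_poly_monic_mul (c d b : B) (s : S) :
  injective sigma -> (forall a, c * a = 0 -> a = 0) ->
  (iota c * t + iota d) * s = iota b -> s = 0.
Proof.
move=> sigma_inj c_reg; have [P [-> _]] := skewS.2 s.
rewrite mulrDl -mulrA (skew_mulXE _ skewS.1) -!hornerZ -!map_polyZ /=.
rewrite -hornerD -rmorphD /= => eqb.
have /polyP PE : c *: skew_mulX P + d *: P = b%:P.
  by apply: skew_horner_inj; rewrite eqb map_polyC hornerC.
have [-> | Pn0] := eqVneq P 0; first by rewrite rmorph0 horner0.
case/negP: Pn0; rewrite -lead_coef_eq0; apply/eqP; apply: sigma_inj.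
(* [size P] is one more than the degree of [P], so only [c * sigma (lead_coef P)] survives at this
   index. *)
rewrite sigma0; apply: c_reg; move: (PE (size P)).
rewrite coefD !coefZ coefD coefMX !coef_map_id0 // coefC.
have [/size_poly_leq0P ->|] := leqP (size P) 0%N.
  by rewrite lead_coef0 sigma0 mulr0.
rewrite /lead_coef; case sP: (size P) => [//|n] _ /=.
by rewrite (@nth_default _ _ _ n.+1) ?sP // delta0 mulr0 !addr0.
Qed.

Lemma skew_poly_ind (D : S -> Prop) :
  D 0 -> (forall a b, D a -> D b -> D (a + b)) ->
  (forall b i, D (iota b * t ^+ i)) -> forall s, D s.
Proof.
move=> D0 DD Dm s; have [P [-> _]] := skewS.2 s.
rewrite horner_coef; elim/big_ind: _ => // i _.
by rewrite coef_map; apply: Dm.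
Qed.

(** Universal property: [f] evaluates the unique coefficient polynomial at [T]. It respects left
    multiplication by [iota b] and by [t], and induction on the left factor then gives
    multiplicativity. *)
Lemma skew_poly_lift (E : nzRingType) (phi : {rmorphism B -> E}) (T : E) :
  (forall b, T * phi b = phi (sigma b) * T + phi (delta b)) ->
  exists f : {rmorphism S -> E}, (forall b, f (iota b) = phi b) /\ f t = T.
Proof.
move=> comm.
have /choice[pol polE] : forall s, exists P : {poly B}, s = (map_poly iota P).[t].
  by move=> s; have [P [-> _]] := skewS.2 s; exists P.
have polK P s : s = (map_poly iota P).[t] -> pol s = P.
  by move=> sP; apply: skew_horner_inj; rewrite -polE.
pose f s := (map_poly phi (pol s)).[T].
have fB : zmod_morphism f.
  move=> a b; rewrite /f (polK (pol a - pol b)) ?rmorphB ?hornerD ?hornerN //.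
  by rewrite -!polE.
have fiota b : f (iota b) = phi b.
  rewrite /f (polK b%:P) ?map_polyC ?hornerC //.
have f1 : f 1 = 1 by rewrite -(rmorph1 iota) fiota rmorph1.
have fbs b s : f (iota b * s) = phi b * f s.
  rewrite /f (polK (b *: pol s)) ?map_polyZ ?hornerZ // -polE //.
have fts s : f (t * s) = T * f s.
  rewrite /f (polK (skew_mulX (pol s))) ?(skew_mulXE _ comm) //.
  by rewrite -(skew_mulXE _ skewS.1) -polE.
have ft : f t = T by rewrite -[t]mulr1 fts f1 mulr1.
have f0 : f 0 = 0 by rewrite -(subrr 0) fB subrr.
have fD a b : f (a + b) = f a + f b.
  by rewrite -[in LHS](opprK b) fB -[- b]sub0r fB f0 sub0r opprK.
have fM : monoid_morphism f.
  split=> // a b; elim/skew_poly_ind: a => [|a1 a2 h1 h2|c i].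
  - by rewrite f0 !mul0r f0.
  - by rewrite mulrDl !fD h1 h2 mulrDl.
  rewrite -mulrA !fbs -mulrA; congr (_ * _).
  by elim: i => [|i IH]; rewrite ?f1 ?mul1r // exprS -mulrA !fts IH mulrA.
pose fA := GRing.isZmodMorphism.Build _ _ f fB.
pose fMm := GRing.isMonoidMorphism.Build _ _ f fM.
pose F : {rmorphism S -> E} := HB.pack f fA fMm.
by exists F.
Qed.

End SkewPolynomials.

(** * Subalgebras and quantum tori *)

Section SubAlgebraType.
Context (K : fieldType) (A : algType K) (S : subalgClosed A).

Definition subalg_type := {a : A | a \in S}.
HB.instance Definition _ := SubChoice.on subalg_type.
HB.instance Definition _ := [SubChoice_isSubAlgebra of subalg_type by <:].

End SubAlgebraType.

Section TorusInduction.
Context (K : fieldType) (p : nat) (Q : nat -> nat -> K) (A : algType K).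
Context (z zV : nat -> A) (torusA : is_quantum_torus p Q z zV).

(* The universal property retracts A onto any subalgebra containing the
   generators, and uniqueness forces the retraction to be the identity. *)
Lemma torus_subalg_full (S : subalgClosed A) :
  (forall i, (1 <= i <= p)%N -> z i \in S /\ zV i \in S) -> forall a, a \in S.
Proof.
move=> gen a; have [rel lift uniq_lift] := torusA.
pose b i : subalg_type S := insubd 0 (z i).
pose bV i : subalg_type S := insubd 0 (zV i).
have valb i : (1 <= i <= p)%N -> val (b i) = z i.
  by move=> /gen[zi _]; rewrite insubdK.
have valbV i : (1 <= i <= p)%N -> val (bV i) = zV i.
  by move=> /gen[_ zVi]; rewrite insubdK.
have valM (x y : subalg_type S) : val (x * y) = val x * val y by exact: rmorphM.
have valB (x y : subalg_type S) : val (x - y) = val x - val y by exact: rmorphB.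
have val1 : val (1 : subalg_type S) = 1 by exact: rmorph1.
have valZ k (x : subalg_type S) : val (k *: x) = k *: val x by exact: linearZ.
have [f fE] : exists f : {lrmorphism A -> subalg_type S},
    forall i, (1 <= i <= p)%N -> f (z i) = b i /\ f (zV i) = bV i.
  apply: lift; split=> [i hi | i j j1 ji ip].
    have [zK zVK] := rel.1 i hi.
    by split; apply: val_inj; rewrite valM val1 valb ?valbV.
  have hj : (1 <= j <= p)%N by rewrite j1 (leq_trans (ltnW ji)).
  have hi : (1 <= i <= p)%N by rewrite ip andbT (leq_trans j1 (ltnW ji)).
  apply: val_inj; rewrite [LHS]valM [RHS]valZ.
  rewrite (valM (b j) (b i)).
  by rewrite (valb i hi) (valb j hj) rel.2.
pose g0 x := val (f x).
have g0B : zmod_morphism g0 by move=> x y; rewrite /g0 -valB -rmorphB.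
have g0M : monoid_morphism g0.
  by split=> [|x y]; rewrite /g0 ?rmorph1 // -valM -rmorphM.
have g0Z : scalable g0 by move=> k x; rewrite /g0 -valZ -linearZ.
pose mB := GRing.isZmodMorphism.Build _ _ g0 g0B.
pose mM := GRing.isMonoidMorphism.Build _ _ g0 g0M.
pose mZ := GRing.isScalable.Build _ _ _ _ g0 g0Z.
pose g : {lrmorphism A -> A} := HB.pack g0 mB mM mZ.
have gK i : (1 <= i <= p)%N -> g (z i) = z i /\ g (zV i) = zV i.
  by move=> hi; split; [rewrite -[RHS]valb | rewrite -[RHS]valbV] => //;
     congr val; have [] := fE i hi.
have <- : val (f a) = a; last exact: valP.
exact: (uniq_lift A g idfun gK a).
Qed.

(** The elements satisfying [D] form a subalgebra that contains the generators. *)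
Lemma torus_ind (D : A -> Prop) :
  D 1 -> (forall k a b, D a -> D b -> D (k *: a + b)) ->
  (forall a b, D a -> D b -> D (a * b)) ->
  (forall i, (1 <= i <= p)%N -> D (z i) /\ D (zV i)) -> forall a, D a.
Proof.
move=> D1 Dlin DM Dz a.
pose S : {pred A} := fun a => `[< D a >].
have clS : subalg_closed S.
  split; first exact/asboolP.
    by move=> k x y /asboolP Dx /asboolP Dy; apply/asboolP/Dlin.
  by move=> x y /asboolP Dx /asboolP Dy; apply/asboolP/DM.
pose S' : subalgClosed A := HB.pack S (GRing.isSubalgClosed.Build K A S clS).
apply/asboolP; apply: (@torus_subalg_full S') => i /Dz[? ?].
by split; apply/asboolP.
Qed.

End TorusInduction.

(** * Monomials of the quantum torus *)

Section QCommutation.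
Context (K : fieldType) (q : K) (q_neq0 : q != 0) (A : algType K).

Definition qcomm (k : int) (g h : A) := g * h = q ^ k *: (h * g).

Lemma qcomm1 (g : A) : qcomm 0 g 1.
Proof. by rewrite /qcomm scale1r mulr1 mul1r. Qed.

Lemma qcommM k l (g h h' : A) :
  qcomm k g h -> qcomm l g h' -> qcomm (k + l) g (h * h').
Proof.
rewrite /qcomm => gh gh'.
by rewrite mulrA gh -scalerAl -[h * g * h']mulrA gh' -scalerAr scalerA mulrA expfzDr.
Qed.

Lemma qcomm_sym k (g h : A) : qcomm k g h -> qcomm (- k) h g.
Proof.
by rewrite /qcomm => ->; rewrite scalerA -expfzDr // addNr scale1r.
Qed.

Lemma qcommV k (g h hV : A) :
  h * hV = 1 -> hV * h = 1 -> qcomm k g h -> qcomm (- k) g hV.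
Proof.
rewrite /qcomm => hK hVK gh.
have -> : hV * g = q ^ k *: (g * hV).
  rewrite -[g in LHS]mulr1 -hK !mulrA -[hV * g * h]mulrA gh -scalerAr -scalerAl.
  by rewrite mulrA hVK mul1r.
by rewrite scalerA -expfzDr // addNr scale1r.
Qed.

Lemma qcommX k (g h : A) n : qcomm k g h -> qcomm (k * n%:Z) g (h ^+ n).
Proof.
move=> gh; elim: n => [|n IH]; first by rewrite mulr0; apply: qcomm1.
by rewrite exprS intS mulrDr mulr1; apply: qcommM.
Qed.

End QCommutation.

Section TorusMonomials.
Context (K : fieldType) (q : K) (q_neq0 : q != 0) (p : nat) (A : algType K).
Context (z zV : nat -> A).
Hypothesis rel : quantum_torus_relations p (torus_coef q) z zV.

(* The generator z_(i+1) has index i, so that 'I_p indexes the generators. *)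
Definition torus_form (j i : nat) : int :=
  if odd j then - (~~ odd i && (i < j)%N)%:Z else (odd i && (j < i)%N)%:Z.

Definition zpow (i : nat) (k : int) : A :=
  match k with Posz n => z i.+1 ^+ n | Negz n => zV i.+1 ^+ n.+1 end.

Definition torus_mon (n : nat) (e : nat -> int) : A := \prod_(i < n) zpow i (e i).

(** Exponent of [q] that appears when the generator of index [j] passes a monomial with exponents
    [e]; see [qcomm_mon]. *)
Definition torus_weight (n j : nat) (e : nat -> int) : int :=
  \sum_(i < n) torus_form j i * e i.

Lemma gen_mulV i : (i < p)%N -> z i.+1 * zV i.+1 = 1.
Proof. by move=> ip; have [] := rel.1 i.+1 ip. Qed.

Lemma gen_mulVl i : (i < p)%N -> zV i.+1 * z i.+1 = 1.
Proof. by move=> ip; have [] := rel.1 i.+1 ip. Qed.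

Lemma qcomm_gen j i : (j < p)%N -> (i < p)%N ->
  qcomm q (torus_form j i) (z j.+1) (z i.+1).
Proof.
move=> jp ip; rewrite /torus_form; have [ij|ji|->] := ltngtP i j.
- rewrite /qcomm rel.2 // /torus_coef /= negbK andbF andbT.
  by case: (odd j); case: (odd i).
(* The relations put the larger index on the left; the double negation gives the exponent the shape
   that [qcomm_sym] produces. *)
- have -> : (if odd j then - ((~~ odd i) && false)%:Z else (odd i && true)%:Z)
      = - - (if odd j then 0 else if odd i then 1 else 0).
    by case: (odd j); case: (odd i).
  apply: qcomm_sym => //; rewrite /qcomm rel.2 // /torus_coef /= negbK.
  by case: (odd j); case: (odd i).
- by rewrite !andbF oppr0 if_same /qcomm scale1r.
Qed.

Lemma qcomm_zpow j i k : (j < p)%N -> (i < p)%N ->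
  qcomm q (torus_form j i * k) (z j.+1) (zpow i k).
Proof.
move=> jp ip; have cg := qcomm_gen jp ip.
case: k => n /=; first exact: qcommX.
rewrite NegzE mulrN -mulNr; apply: qcommX => //.
by apply: qcommV (gen_mulV ip) (gen_mulVl ip) cg.
Qed.

Lemma qcomm_mon n j e : (j < p)%N -> (n <= p)%N ->
  qcomm q (torus_weight n j e) (z j.+1) (torus_mon n e).
Proof.
move=> jp; rewrite /torus_weight /torus_mon.
elim: n => [|n IH] np; first by rewrite !big_ord0; apply: qcomm1.
rewrite !big_ord_recr; apply: qcommM => //; last exact: qcomm_zpow.
exact/IH/ltnW.
Qed.

Lemma zpowS i k : (i < p)%N -> zpow i k * z i.+1 = zpow i (k + 1).
Proof.
move=> ip; case: k => [n|[|n]].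
- by rewrite (_ : n%:Z + 1 = n.+1%:Z) /= ?exprSr // intS addrC.
- by rewrite (_ : Negz 0 + 1 = 0) //= expr1 gen_mulVl.
rewrite (_ : Negz n.+1 + 1 = Negz n) /=; last by rewrite !NegzE; lia.
by rewrite exprSr -mulrA gen_mulVl // mulr1.
Qed.

Lemma zpowK i k : (i < p)%N -> zpow i (- k) * zpow i k = 1.
Proof.
move=> ip; have XK (a b : A) n : a * b = 1 -> a ^+ n * b ^+ n = 1.
  move=> ab; elim: n => [|n IH]; first by rewrite mulr1.
  by rewrite exprSr exprS mulrA -[_ * a * b]mulrA ab mulr1.
case: k => [[|n]|n] /=; first by rewrite mulr1.
- by apply: XK; apply: gen_mulVl.
- by apply: XK; apply: gen_mulV.
Qed.

Lemma mon_unit n e : (n <= p)%N -> exists g, g * torus_mon n e = 1.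
Proof.
rewrite /torus_mon; elim: n => [|n IH] np; first by exists 1; rewrite big_ord0 mulr1.
have [g gK] := IH (ltnW np); exists (zpow n (- e n) * g).
by rewrite big_ord_recr /= mulrA -[_ * g * _]mulrA gK mulr1 zpowK.
Qed.

(** The generator moves left past the later factors, each costing a power of [q], until it meets its
    own factor. *)
Lemma mon_mul_gen n j e : (j < n)%N -> (n <= p)%N ->
  exists k : int, torus_mon n e * z j.+1 =
    q ^ k *: torus_mon n (fun i => e i + (i == j)%:Z).
Proof.
rewrite /torus_mon; elim: n => // n IH jn np; rewrite !big_ord_recr /=.
have [jn' | jn'] := eqVneq j n.
  exists 0; rewrite scale1r -mulrA jn' zpowS //; congr (_ * _).
  by apply: eq_bigr => i _; rewrite ltn_eqF // addr0.
have {jn jn'} jn : (j < n)%N by rewrite ltn_neqAle jn' -ltnS.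
have [k kE] := IH jn (ltnW np).
have /(qcomm_sym q_neq0) c := qcomm_zpow (e n) (ltn_trans jn np) np.
rewrite -mulrA c -scalerAr mulrA kE -scalerAl scalerA -expfzDr //.
by eexists; rewrite addr0.
Qed.

(** Apply [mon_mul_gen] to the lowered exponents and cancel the generator on the right. *)
Lemma mon_mul_genV n j e : (j < n)%N -> (n <= p)%N ->
  exists k : int, torus_mon n e * zV j.+1 =
    q ^ k *: torus_mon n (fun i => e i - (i == j)%:Z).
Proof.
move=> jn np; have jp := leq_trans jn np.
have [k kE] := mon_mul_gen (fun i => e i - (i == j)%:Z) jn np; exists (- k).
have -> : torus_mon n e = torus_mon n (fun i => e i - (i == j)%:Z + (i == j)%:Z).
  by apply: eq_bigr => i _; rewrite subrK.
have /(congr1 (fun a => q ^ (- k) *: (a * zV j.+1))) := kE.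
rewrite -mulrA gen_mulV // mulr1 => ->.
by rewrite -scalerAl scalerA -expfzDr // addNr scale1r.
Qed.

(** Indices are shifted by one: an even index [i] is the generator [z i.+1] of odd number, one that
    [alpha] rescales. *)
Definition odd_degree (n : nat) (e : nat -> int) : int :=
  \sum_(i < n | ~~ odd i) e i.

(* The skew-symmetric form has radical spanned by the last generator, on which
   the total degree in the z_i with i odd is nonzero. *)
Lemma torus_weights_inj (d : nat -> int) : odd p ->
  (forall j, (j < p)%N -> torus_weight p j d = 0) -> odd_degree p d = 0 ->
  forall i, (i < p)%N -> d i = 0.
Proof.
move=> p_odd w0 deg0.
(* Prefix sums of the exponents over one parity. Weights at odd [j] are, up to sign, prefix sums
   over even indices; weights at even [j] are tail sums over odd indices. Once all prefix sums
   vanish, so do their differences [d i]. *)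
pose U b k := \sum_(i < k | odd i == b) d i.
have US b k : U b k.+1 = U b k + (if odd k == b then d k else 0).
  rewrite /U [LHS]big_mkcond big_ord_recr /=; congr (_ + _).
  by rewrite -big_mkcond.
have Ufull b k : (k <= p)%N -> U b k = \sum_(i < p | (odd i == b) && (i < k)%N) d i.
  move=> kp; by rewrite /U (big_ord_widen_cond p (fun i => odd i == b)).
have w_odd j : odd j ->
    torus_weight p j d = - \sum_(i < p | (odd i == false) && (i < j)%N) d i.
  move=> jo; rewrite /torus_weight -sumrN [RHS]big_mkcond /=; apply: eq_bigr => i _.
  rewrite /torus_form jo eqbF_neg.
  by case: ifP => _; rewrite ?mulN1r // oppr0 mul0r.
have w_even j : ~~ odd j -> (j < p)%N -> torus_weight p j d = U true p - U true j.+1.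
  move=> je jp; rewrite (Ufull true j.+1) // (Ufull true p) //.
  rewrite /torus_weight big_mkcond [X in X - _]big_mkcond /=.
  rewrite [X in _ - X]big_mkcond -sumrB.
  apply: eq_bigr => i _; rewrite /torus_form (negbTE je) ltn_ord andbT eqb_id ltnS.
  by case: (odd i); case: (ltnP j i) => _; rewrite /= ?(mul1r, mul0r, subr0, subrr).
have Uf k : (k <= p)%N -> U false k = 0.
  have Uodd k' : odd k' -> (k' <= p)%N -> U false k' = 0.
    move=> ko; rewrite leq_eqVlt => /orP[/eqP-> | kp].
      (* At [k' = p] no weight is available, but this prefix sum is the whole odd degree. *)
      by rewrite -[RHS]deg0 /U /odd_degree; under eq_bigl do rewrite eqbF_neg.
    by apply: oppr_inj; rewrite oppr0 -(w0 _ kp) w_odd // Ufull // ltnW.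
  case: k => [|k] kp; first by rewrite /U big_ord0.
  have [ko | ke] := boolP (odd k.+1); first exact: Uodd.
  move: ke; rewrite /= negbK => ke; rewrite US ke addr0; apply: Uodd => //.
  exact: ltnW.
have Ut k : (k <= p)%N -> U true k = 0.
  have Ueven j : ~~ odd j -> (j < p)%N -> U true j = U true p.
    move=> je jp; have := w_even j je jp; rewrite w0 // US (negbTE je) /= addr0.
    by move/esym/eqP; rewrite subr_eq0 => /eqP.
  (* The tail sum after index [0] is the full sum, since the prefix before it is empty. *)
  have Up : U true p = 0 by rewrite -(Ueven 0%N isT (odd_gt0 p_odd)) /U big_ord0.
  rewrite leq_eqVlt => /orP[/eqP-> // | kp].
  have [ko | ke] := boolP (odd k); last by rewrite Ueven.
  case: k ko kp => // k /= ke kp; rewrite US (negbTE ke) addr0 Ueven //.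
  exact: ltnW.
move=> i ip; case io: (odd i).
  by have := Ut i.+1 ip; rewrite US io Ut ?(ltnW ip) // add0r.
by have := Uf i.+1 ip; rewrite US io Uf ?(ltnW ip) // add0r.
Qed.

End TorusMonomials.

(** * Shortening linear combinations *)

Section SeparateTerms.
Context (K : fieldType) (X : eqType) (V : lmodType K) (J : V -> Prop).
Context (m : nat -> X -> V).
Hypothesis JZ : forall k v, J v -> J (k *: v).
Hypothesis separate : forall N e e', e != e' -> exists N' (w : X -> K),
  [/\ w e = 0, w e' != 0
    & forall s c, J (\sum_(f <- s) c f *: m N f) ->
        J (\sum_(f <- s) (c f * w f) *: m N' f)].

(** Separating the first two terms kills the first and keeps the second, so the combination gets
    shorter but stays nonempty. The index [N] may change on the way; it will be the power of the
    skew variable. *)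
Lemma separate_terms (N : nat) (s : seq X) (c : X -> K) :
  uniq s -> s != [::] -> (forall f, f \in s -> c f != 0) ->
  J (\sum_(f <- s) c f *: m N f) -> exists N' e, J (m N' e).
Proof.
have [n] := ubnP (size s); elim: n => // n IH in N s c *.
case: s => [//|e [|e' s]] ltn uniq_s _ cn0 Js.
  move: Js; rewrite big_seq1 => /(JZ (c e)^-1).
  by rewrite scalerA mulVf ?cn0 ?mem_seq1 // scale1r; exists N, e.
have ee' : e != e'.
  by move: uniq_s; rewrite /= inE negb_or -andbA => /andP[].
have [N' [w [we we' /(_ _ _ Js) Js']]] := separate N ee'.
apply: (IH N' [seq f <- [:: e, e' & s] | w f != 0] (fun f => c f * w f)).
- rewrite /= we eqxx /= we' /=; move: ltn; rewrite ltnS; apply: leq_trans.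
  by rewrite !ltnS size_filter count_size.
- exact: filter_uniq.
- by rewrite /= we eqxx /= we'.
- by move=> f; rewrite mem_filter => /andP[wf fs]; rewrite mulf_neq0 ?cn0.
rewrite big_filter big_mkcond /= (eq_bigr (fun f => (c f * w f) *: m N' f)) //.
by move=> f _; case: eqP => [->|//]; rewrite mulr0 scale0r.
Qed.

End SeparateTerms.

(** Terms with equal keys are merged by additivity: each pair of [l] meets exactly one key of the
    duplicate-free list. *)
Lemma big_collect (I : eqType) (U V : nmodType) (F : I -> U -> V)
    (l : seq (I * U)) :
  (forall i, F i 0 = 0) -> (forall i, {morph F i : a b / a + b}) ->
  \sum_(k <- l) F k.1 k.2 =
  \sum_(i <- undup (unzip1 l)) F i (\sum_(k <- l | k.1 == i) k.2).
Proof.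
move=> F0 FD; under [RHS]eq_bigr do rewrite (big_morph _ (FD _) (F0 _)).
rewrite (exchange_big_dep xpredT) //= [LHS]big_seq [RHS]big_seq.
apply: eq_bigr => k kl; rewrite -big_filter.
rewrite (_ : [seq _ <- _ | _] = [:: k.1]) ?big_seq1 //.
rewrite -(filter_pred1_uniq (undup_uniq (unzip1 l)) (x := k.1)) ?mem_undup.
  by apply: eq_filter => i /=; rewrite eq_sym.
exact: map_f.
Qed.

(** * Monomials span the torus; diagonal automorphisms *)

Section TorusSpan.
Context (K : fieldType) (q : K) (q_neq0 : q != 0) (p : nat) (A : algType K).
Context (z zV : nat -> A).
Hypothesis torusA : is_quantum_torus p (torus_coef q) z zV.

Let rel : quantum_torus_relations p (torus_coef q) z zV.
Proof. by case: torusA. Qed.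

(** Finite functions have decidable equality, which [separate_terms] requires of its index type;
    [torus_mon] expects a function on [nat]. *)
Definition ext_exponent (e : {ffun 'I_p -> int}) (i : nat) : int :=
  oapp e 0 (insub i).

Definition tmon (e : {ffun 'I_p -> int}) : A := torus_mon z zV p (ext_exponent e).

Lemma ext_exponentE e (i : 'I_p) : ext_exponent e i = e i.
Proof. by rewrite /ext_exponent valK. Qed.

Lemma tmonE (f : nat -> int) : torus_mon z zV p f = tmon [ffun i : 'I_p => f i].
Proof. by apply: eq_bigr => i _; rewrite ext_exponentE ffunE. Qed.

Lemma torus_span (a : A) : exists l : seq ({ffun 'I_p -> int} * K),
  a = \sum_(k <- l) k.2 *: tmon k.1.
Proof.
pose span b := exists l : seq ({ffun 'I_p -> int} * K),
  b = \sum_(k <- l) k.2 *: tmon k.1.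
have span0 : span 0 by exists [::]; rewrite big_nil.
have spanD b c : span b -> span c -> span (b + c).
  by move=> [l ->] [l' ->]; exists (l ++ l'); rewrite big_cat.
have spanZ k b : span b -> span (k *: b).
  move=> [l ->]; exists [seq (x.1, k * x.2) | x <- l].
  by rewrite big_map scaler_sumr; apply: eq_bigr => x _; rewrite scalerA.
have span_mon f k : span (k *: torus_mon z zV p f).
  by exists [:: ([ffun i : 'I_p => f i], k)]; rewrite big_seq1 tmonE.
have spanM g : (forall e, span (tmon e * g)) -> forall b, span b -> span (b * g).
  move=> Hg b [l ->]; rewrite mulr_suml; elim/big_ind: _ => // x _.
  by rewrite -scalerAl; apply: spanZ.
(* Unlike membership of [a] in the span, stability of the span under right multiplication by [a]
   passes to products at once. *)
suff : forall b, span b -> span (b * a).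
  move/(_ 1); rewrite mul1r; apply.
  rewrite -[1]scale1r (_ : 1%R = torus_mon z zV p (fun=> 0)) //.
  by rewrite /torus_mon big1.
elim/(torus_ind torusA) : a => [b|k a a' Ha Ha' b bs|a a' Ha Ha' b bs|i ip].
- by rewrite mulr1.
- rewrite mulrDr -scalerAr; apply: spanD; first exact/spanZ/Ha.
  exact: Ha'.
- by rewrite mulrA; apply/Ha'/Ha.
case: i ip => // i ip.
split; apply: spanM => e; rewrite /tmon.
  have [k ->] := mon_mul_gen q_neq0 rel (ext_exponent e) ip (leqnn p).
  exact: span_mon.
have [k ->] := mon_mul_genV q_neq0 rel (ext_exponent e) ip (leqnn p).
exact: span_mon.
Qed.

Lemma torus_uniq_span (a : A) : exists (s : seq {ffun 'I_p -> int}) (c : _ -> K),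
  [/\ uniq s, forall e, e \in s -> c e != 0 & a = \sum_(e <- s) c e *: tmon e].
Proof.
have [l ->] := torus_span a.
pose c e := \sum_(k <- l | k.1 == e) k.2.
exists [seq e <- undup (unzip1 l) | c e != 0], c; split.
- exact/filter_uniq/undup_uniq.
- by move=> e; rewrite mem_filter => /andP[].
rewrite (@big_collect _ _ _ (fun e k => k *: tmon e)); last 2 first.
- by move=> e; rewrite scale0r.
- by move=> e k k'; rewrite scalerDl.
rewrite big_filter [RHS]big_mkcond /=; apply: eq_bigr => e _.
by case: eqP => [|//]; rewrite -/(c e) => ->; rewrite scale0r.
Qed.

Section Automorphism.
Context (tau : {lrmorphism A -> A}) (h : K) (h_neq0 : h != 0).
Hypothesis tau_gen : forall i, (i < p)%N ->
  tau (z i.+1) = (if odd i then 1 else h) *: z i.+1.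

Lemma tau_genV i : (i < p)%N ->
  tau (zV i.+1) = (if odd i then 1 else h^-1) *: zV i.+1.
Proof.
move=> ip; have := congr1 tau (gen_mulVl rel ip).
rewrite rmorphM rmorph1 /= tau_gen // -scalerAr => /(congr1 (fun a => a * zV i.+1)).
rewrite -scalerAl -mulrA (gen_mulV rel) // mulr1 mul1r => zVE.
rewrite -[in RHS]zVE.
by case: (odd i); rewrite scalerA ?mulr1 ?mulVf // ?scale1r.
Qed.

(** [tau] will be [alpha] with [h = q^-1], and [alphaV] with [h = q]. Monomials are eigenvectors
    because the generators are. *)
Lemma tau_mon n (e : nat -> int) : (n <= p)%N ->
  tau (torus_mon z zV n e) = h ^ odd_degree n e *: torus_mon z zV n e.
Proof.
rewrite /torus_mon /odd_degree.
elim: n => [|n IH] np; first by rewrite !big_ord0 rmorph1 scale1r.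
rewrite !big_ord_recr rmorphM /= IH ?(ltnW np) //.
have -> : tau (zpow z zV n (e n)) =
    h ^ (if ~~ odd n then e n else 0) *: zpow z zV n (e n).
  case: (e n) => k /=; rewrite rmorphXn /= ?tau_gen ?tau_genV // exprZn;
    case: (odd n); rewrite ?expr1n ?scale1r //=.
  by rewrite exprVn.
rewrite [X in _ = h ^ X *: _]big_mkcond big_ord_recr -big_mkcond /=.
by rewrite -scalerAl -scalerAr scalerA expfzDr.
Qed.

End Automorphism.
End TorusSpan.

(** * Ideals *)

Section LaurentBezout.
Context (K : fieldType) (A : algType K) (Z ZV : A) (L : A -> Prop).
Hypotheses (ZK : Z * ZV = 1).
Hypotheses (LD : forall a b, L a -> L b -> L (a + b)).
Hypotheses (LM : forall a b, L b -> L (a * b)).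

Definition laurent (s b l : K) : A := s *: ZV + b *: Z + l *: 1.

Lemma laurentD s b l s' b' l' :
  laurent s b l + laurent s' b' l' = laurent (s + s') (b + b') (l + l').
Proof.
rewrite /laurent addrACA (addrACA (s *: ZV)) -!scalerDl //.
Qed.

Lemma laurentZ k s b l : k *: laurent s b l = laurent (k * s) (k * b) (k * l).
Proof. by rewrite /laurent !scalerDr !scalerA. Qed.

(** The two elements are [w(Z)] and [w(k Z)] for one Laurent polynomial [w]. The inequality says
    that their resultant is nonzero, and eliminating [Z] produces that resultant as a scalar in the
    left ideal [L]. *)
Lemma laurent_bezout (s b l k : K) : k != 0 -> k != 1 ->
  l ^+ 2 * k != s * b * (k + 1) ^+ 2 ->
  L (laurent s b l) -> L (laurent (s * k^-1) (b * k) l) -> L 1.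
Proof.
move=> k0 k1 res L1 L2.
have LZ c a : L a -> L (c *: a) by move=> La; rewrite -mulr_algl; apply: LM.
have k1' : 1 - k != 0 by rewrite subr_eq0 eq_sym.
(* The difference of the two elements, divided by [1 - k], has no constant term. *)
have LV : L (laurent (- (s * k^-1)) b 0).
  have := LZ (1 - k)^-1 _ (LD L1 (LZ (-1) _ L2)).
  rewrite laurentZ laurentD laurentZ; congr (L (laurent _ _ _)); field.
  - by rewrite k0 k1'.
  - by rewrite k1'.
  - by rewrite k1'.
have LV' : L (laurent (s * (1 + k^-1)) 0 l).
  have := LD L1 (LZ (-1) _ LV).
  by rewrite laurentZ laurentD; congr (L (laurent _ _ _)); ring.
have LU : L (laurent 0 (b * (1 + k)) l).
  have := LD L1 (LZ k _ LV).
  by rewrite laurentZ laurentD; congr (L (laurent _ _ _)); field.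
(* Multiplying by [Z] leaves two polynomials of degree at most one in [Z], and a last combination
   removes [Z]. *)
have LZV' : L (laurent 0 l (s * (1 + k^-1))).
  have := LM Z LV'; rewrite /laurent !mulrDr -!scalerAr ZK mulr1 !scale0r.
  by rewrite addr0 add0r addrC mulr1.
have := LD (LZ l _ LU) (LZ (- (b * (1 + k))) _ LZV').
rewrite !laurentZ laurentD.
set c1 := _ + _; set c2 := _ + _; set c3 := _ + _.
have -> : c1 = 0 by rewrite /c1; ring.
have -> : c2 = 0 by rewrite /c2; ring.
have c3n0 : c3 != 0.
  have -> : c3 = (l ^+ 2 * k - s * b * (k + 1) ^+ 2) / k by rewrite /c3; field.
  by rewrite mulf_neq0 ?invr_neq0 // subr_eq0.
rewrite /laurent !scale0r !add0r => /(LZ c3^-1).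
by rewrite scalerA mulVf // scale1r.
Qed.

End LaurentBezout.

(** * Two-sided ideals and their homogeneous components *)

Section Ideals.
Context (K : fieldType) (R : algType K) (J : R -> Prop).
Hypothesis idealJ : two_sided_ideal J.

Lemma tsi0 : J 0. Proof. by case: idealJ. Qed.
Lemma tsiD a b : J a -> J b -> J (a + b).
Proof. by case: idealJ => _ JD _; apply: JD. Qed.
Lemma tsiMl r a : J a -> J (r * a).
Proof. by case: idealJ => _ _ JM Ja; case: (JM r a Ja). Qed.
Lemma tsiMr r a : J a -> J (a * r).
Proof. by case: idealJ => _ _ JM Ja; case: (JM r a Ja). Qed.
Lemma tsiZ (k : K) a : J a -> J (k *: a).
Proof. by move=> Ja; rewrite -mulr_algl; apply: tsiMl. Qed.
Lemma tsiB a b : J a -> J b -> J (a - b).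
Proof. by move=> Ja Jb; apply: tsiD => //; rewrite -mulN1r; apply: tsiMl. Qed.
Lemma tsi_congr a b : J (a - b) -> J a <-> J b.
Proof.
move=> Jab; split=> [Ja | Jb]; last by rewrite -(subrK b a); apply: tsiD.
by rewrite -(subKr a b); apply: tsiB.
Qed.
Lemma tsi_sum (I : eqType) (s : seq I) (F : I -> R) :
  (forall i, i \in s -> J (F i)) -> J (\sum_(i <- s) F i).
Proof.
move=> JF; rewrite big_seq; elim/big_ind: _ => //; first exact: tsi0.
exact: tsiD.
Qed.

(** The [F d] are eigenvectors of the map sending [r] to [gV * r * g], with distinct eigenvalues,
    and this map preserves [J]. *)
Lemma tsi_homogeneous (g gV : R) (w : int -> K) (s : seq int) (F : int -> R) :
  (forall d, gV * F d * g = w d *: F d) -> injective w -> uniq s ->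
  J (\sum_(d <- s) F d) -> forall d, d \in s -> J (F d).
Proof.
move=> wF w_inj; elim: s F wF => // d0 s IH F wF /= /andP[d0s uniq_s].
rewrite big_cons => Js.
have Jtail d : d \in s -> J (F d).
  move=> ds; have wd : w d - w d0 != 0.
    rewrite subr_eq0; apply: contraNneq d0s => /w_inj <- //.
  have : J ((w d - w d0) *: F d).
    apply: (IH (fun d => (w d - w d0) *: F d)) => //.
      by move=> d'; rewrite -scalerAr -scalerAl wF !scalerA mulrC.
    (* Subtracting [w d0] times the sum cancels the head and rescales the tail by the nonzero
       [w d - w d0]. *)
    have := tsiB (tsiMl gV (tsiMr g Js)) (tsiZ (w d0) Js).
    rewrite mulrDl mulrDr scalerDr mulrA wF opprD addrACA subrr add0r.
    rewrite mulr_suml mulr_sumr scaler_sumr -sumrB; congr J.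
    by apply: eq_bigr => d' _; rewrite mulrA wF scalerBl.
  by move/(tsiZ (w d - w d0)^-1); rewrite scalerA mulVf // scale1r.
move=> d; rewrite inE => /orP[/eqP->|]; last exact: Jtail.
by rewrite -(addrK (\sum_(j <- s) F j) (F d0)); apply/tsiB/tsi_sum.
Qed.

End Ideals.

(** * Descent on powers of [t], which is [y] with [tau = alpha] or [x] with [tau = alphaV] *)

Section PowerDescent.
Context (K : fieldType) (q : K) (q_neq0 : q != 0) (p : nat) (p_odd : odd p).
Context (A : algType K) (z zV : nat -> A).
Hypothesis torusA : is_quantum_torus p (torus_coef q) z zV.
Context (tau : {lrmorphism A -> A}) (h : K) (h_neq0 : h != 0).
Hypothesis tau_gen : forall i, (i < p)%N ->
  tau (z i.+1) = (if odd i then 1 else h) *: z i.+1.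
Hypotheses (q_inj : injective (exprz q)) (h_inj : injective (exprz h)).
Context (R : algType K) (iota : {lrmorphism A -> R}) (t : R).
Hypothesis t_iota : forall a, t * iota a = iota (tau a) * t.
Context (J : R -> Prop) (idealJ : two_sided_ideal J).

Let rel : quantum_torus_relations p (torus_coef q) z zV.
Proof. by case: torusA. Qed.

Lemma skew_exp_iota n a : t ^+ n * iota a = iota (iter n tau a) * t ^+ n.
Proof.
elim: n a => [|n IH] a; first by rewrite mul1r mulr1.
by rewrite exprSr -mulrA t_iota mulrA IH iterSr mulrA.
Qed.

Let hj j : K := if odd j then 1 else h.

Lemma iter_tau_gen n j : (j < p)%N -> iter n tau (z j.+1) = hj j ^+ n *: z j.+1.
Proof.
move=> jp; elim: n => [|n IH]; first by rewrite scale1r.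
by rewrite iterS IH linearZ /= tau_gen // scalerA exprSr.
Qed.

(** One factor comes from moving [t ^+ n] past the generator, the other from moving the monomial
    past it. *)
Lemma conj_tmon n j (e : {ffun 'I_p -> int}) : (j < p)%N ->
  iota (zV j.+1) * (iota (tmon z zV e) * t ^+ n) * iota (z j.+1) =
  (hj j ^+ n * q ^ (- torus_weight p j (ext_exponent e))) *:
    (iota (tmon z zV e) * t ^+ n).
Proof.
move=> jp; set M := tmon z zV e.
have MzE : zV j.+1 * (M * z j.+1) =
    q ^ (- torus_weight p j (ext_exponent e)) *: M.
  have -> : M * z j.+1 = q ^ (- torus_weight p j (ext_exponent e)) *: (z j.+1 * M).
    exact/(qcomm_sym q_neq0)/(qcomm_mon q_neq0 rel).
  by rewrite -scalerAr mulrA (gen_mulVl rel) // mul1r.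
have iotaE : iota (zV j.+1) * (iota M * (iota (z j.+1) * t ^+ n)) =
    iota (zV j.+1 * (M * z j.+1)) * t ^+ n.
  by rewrite !rmorphM /= !mulrA.
rewrite -(mulrA (iota (zV j.+1))) -(mulrA (iota M)) skew_exp_iota.
rewrite iter_tau_gen // linearZ /= -scalerAl -!scalerAr iotaE MzE.
by rewrite linearZ /= -scalerAl scalerA.
Qed.

(** Terms are separated until a single monomial times a power of [t] remains; the left inverse of
    the monomial then strips it off. *)
Lemma tsi_reduce_to_power n a : a != 0 -> J (iota a * t ^+ n) ->
  exists n', J (t ^+ n').
Proof.
have [s [c [uniq_s cn0 ->]]] := torus_uniq_span q_neq0 torusA a.
move=> an0 Ja.
pose m n (e : {ffun 'I_p -> int}) := iota (tmon z zV e) * t ^+ n.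
have sn0 : s != [::] by apply: contraNneq an0 => ->; rewrite big_nil.
have {}Ja : J (\sum_(f <- s) c f *: m n f).
  move: Ja; rewrite linear_sum mulr_suml; congr J.
  by apply: eq_bigr => f _; rewrite linearZ -scalerAl.
suff [n' [e Je]] : exists n' e, J (m n' e).
  have [g gK] := mon_unit rel (ext_exponent e) (leqnn p).
  exists n'; move: (tsiMl idealJ (iota g) Je).
  by rewrite /m mulrA -rmorphM /= gK rmorph1 mul1r.
apply: (separate_terms _ _ uniq_s sn0 cn0 Ja) => [k v|n1 e e' ee'].
  exact: tsiZ.
(* If some weights differ, conjugation by that generator separates the terms and keeps the power of
   [t]. *)
have [/forallP eqw | ] :=
    boolP [forall j : 'I_p, torus_weight p j (ext_exponent e) ==
                            torus_weight p j (ext_exponent e')]; last first.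
  rewrite negb_forall => /existsP[[j jp] /= wne].
  pose ww (f : {ffun 'I_p -> int}) :=
    hj j ^+ n1 * q ^ (- torus_weight p j (ext_exponent f)).
  exists n1, (fun f => ww f - ww e); split; first by rewrite subrr.
    rewrite /ww -mulrBr mulf_neq0 //.
      by rewrite expf_neq0 // /hj; case: (odd j); rewrite ?oner_eq0.
    by rewrite subr_eq0; apply: contra wne => /eqP/q_inj/oppr_inj ->.
  move=> s' c' Js'.
  have := tsiB idealJ
    (tsiMr idealJ (iota (z j.+1)) (tsiMl idealJ (iota (zV j.+1)) Js'))
    (tsiZ idealJ (ww e) Js').
  rewrite mulr_sumr mulr_suml scaler_sumr -sumrB; congr J.
  apply: eq_bigr => f _; rewrite -scalerAr -scalerAl conj_tmon // !scalerA -scalerBl.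
  by congr (_ *: _); rewrite mulrBr [ww e * _]mulrC.
(* If all weights agree, [torus_weights_inj] forces distinct odd degrees. Multiplying by [t] on the
   left and on the right then differs by distinct powers of [h], and the power of [t] grows by
   one. *)
pose ww (f : {ffun 'I_p -> int}) := h ^ odd_degree p (ext_exponent f).
exists n1.+1, (fun f => ww f - ww e); split; first by rewrite subrr.
  rewrite subr_eq0; apply: contra ee' => /eqP/h_inj eqd.
  apply/eqP/ffunP => i; apply/eqP; rewrite -subr_eq0 -!ext_exponentE; apply/eqP.
  apply: (@torus_weights_inj p (fun i => ext_exponent e i - ext_exponent e' i)) => //.
    move=> j jp; rewrite /torus_weight; under eq_bigr do rewrite mulrBr.
    rewrite sumrB; have /eqP := eqw (Ordinal jp).
    by rewrite /torus_weight /= => ->; rewrite subrr.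
  by rewrite /odd_degree sumrB; move: eqd; rewrite /odd_degree => ->; rewrite subrr.
move=> s' c' Js'.
have := tsiB idealJ (tsiMl idealJ t Js') (tsiZ idealJ (ww e) (tsiMr idealJ t Js')).
rewrite mulr_sumr mulr_suml scaler_sumr -sumrB; congr J.
apply: eq_bigr => f _; rewrite -scalerAr -scalerAl /m mulrA t_iota.
rewrite /tmon (tau_mon torusA h_neq0 tau_gen) // linearZ -!scalerAl /=.
rewrite -!mulrA -exprS -exprSr.
rewrite !scalerA -scalerBl.
by congr (_ *: _); rewrite mulrBr [ww e * _]mulrC.
Qed.

Lemma iter_tau_laurent n j s b l : (j < p)%N -> ~~ odd j ->
  iter n tau (laurent (z j.+1) (zV j.+1) s b l) =
  laurent (z j.+1) (zV j.+1) (s * (h ^+ n)^-1) (b * h ^+ n) l.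
Proof.
move=> jp je; elim: n => [|n IH]; first by rewrite invr1 !mulr1.
rewrite iterS IH /laurent !linearD !linearZ /= rmorph1.
rewrite (tau_genV torusA h_neq0 tau_gen) // tau_gen // (negbTE je) !scalerA.
by rewrite exprSr invfM mulrA mulrA.
Qed.

(** Multiplying [t ^+ n.+1] by [t'] on either side puts [w] and [tau^(n+1)(w)], times [t ^+ n], into
    [J]. These coefficients are comaximal, so [t ^+ n] is in [J]. *)
Lemma tsi_power_descent (t' : R) j (s b l : K) n :
  (j < p)%N -> ~~ odd j ->
  J (t' * t - iota (laurent (z j.+1) (zV j.+1) s b l)) ->
  J (t * t' - iota (tau (laurent (z j.+1) (zV j.+1) s b l))) ->
  (forall k, (0 < k)%N -> l ^+ 2 * h ^+ k != s * b * (h ^+ k + 1) ^+ 2) ->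
  J (t ^+ n) -> J 1.
Proof.
move=> jp je; set w := laurent _ _ _ _ _ => Jt't Jtt' res.
elim: n => // n IH Jn; apply: IH.
have J1 : J (iota w * t ^+ n).
  apply: ((tsi_congr idealJ _).1 (tsiMl idealJ t' Jn)).
  by rewrite exprS mulrA -mulrBl; apply: tsiMr.
have J2 : J (iota (iter n.+1 tau w) * t ^+ n).
  apply: ((tsi_congr idealJ _).1 (tsiMr idealJ t' Jn)).
  rewrite iterSr -skew_exp_iota exprSr -mulrA -mulrBr.
  exact: tsiMl.
rewrite -[t ^+ n]mul1r -(rmorph1 iota).
(* The coefficients [a] with [iota a * t ^+ n] in [J] form a left ideal of [A]. *)
apply: (@laurent_bezout _ _ (z j.+1) (zV j.+1) (fun a => J (iota a * t ^+ n))
  _ _ _ s b l (h ^+ n.+1)) => //.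
- exact: (gen_mulV rel).
- by move=> a a' Ja Ja'; rewrite rmorphD mulrDl; apply: tsiD.
- by move=> a a' Ja; rewrite rmorphM -mulrA; apply: tsiMl.
- by rewrite expf_neq0.
- by apply/eqP => /(h_inj (x1 := n.+1) (x2 := 0)).
- exact: res.
- by rewrite -iter_tau_laurent.
Qed.

End PowerDescent.

(** * Ambiskew polynomial rings *)

Section Ambiskew.
Context (K : fieldType) (A R : algType K) (alpha alphaV : {lrmorphism A -> A}).
Hypotheses (alphaK : cancel alpha alphaV) (alphaVK : cancel alphaV alpha).
Context (u v : A) (v_def : v = u - alpha u).
Context (iota : {lrmorphism A -> R}) (y x : R).
Hypothesis R_ambiskew : is_ambiskew_poly_ring alpha alphaV v iota y x.

Lemma ambiskew_y_iota a : y * iota a = iota (alpha a) * y.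
Proof.
case: R_ambiskew => S [iS [jR [yS [beta [delta [[skS _ iE yE] _ _]]]]]].
by rewrite !iE yE -!rmorphM skS.1 rmorph0 addr0.
Qed.

Lemma ambiskew_x_iota a : x * iota a = iota (alphaV a) * x.
Proof.
case: R_ambiskew => S [iS [jR [yS [beta [delta [[_ skR iE _] [_ bE _] [_ dE _]]]]]]].
by rewrite !iE skR.1 bE dE rmorph0 addr0.
Qed.

Lemma ambiskew_xy : x * y = y * x + iota v.
Proof.
case: R_ambiskew => S [iS [jR [yS [beta [delta [[_ skR iE yE] [_ _ bE] [_ _ dE]]]]]]].
by rewrite yE iE skR.1 bE dE.
Qed.

Lemma ambiskew_ind (D : R -> Prop) :
  D 0 -> (forall a b, D a -> D b -> D (a + b)) ->
  (forall a i j, D (iota a * y ^+ j * x ^+ i)) -> forall r, D r.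
Proof.
case: R_ambiskew => S [iS [jR [yS [beta [delta [[skS skR iE yE] _ _]]]]]].
move=> D0 DD Dm; elim/(skew_poly_ind skR) => // b i.
elim/(skew_poly_ind skS): b => [|b b' Db Db'|a j].
- by rewrite rmorph0 mul0r.
- by rewrite rmorphD mulrDl; apply: DD.
- by rewrite rmorphM rmorphXn /= -yE -iE.
Qed.

(** With [y] on the left, the divisor has degree one in [x] and leading coefficient [y], which is
    regular in [A[y; alpha]]. A multiple of degree zero in [x] is therefore zero, while [y ^+ n] is
    not. *)
Lemma ambiskew_monic_ndvd (a : A) (n : nat) :
  ~ principal_right (x * y - iota a) (y ^+ n).
Proof.
case: R_ambiskew => S [iS [jR [yS [beta [delta [[skS skR iE yE] [bb _ bE] [_ _ dE]]]]]]].
have alpha_inj := can_inj alphaK.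
have jR_inj b b' : jR b = jR b' -> b = b'.
  move=> bb'; apply: polyC_inj; apply: (skew_horner_inj skR).
  by rewrite !map_polyC !hornerC.
have -> : x * y - iota a = jR yS * x + jR (iS (v - a)).
  by rewrite ambiskew_xy yE !iE -addrA -!rmorphB.
case=> s sE.
have s0 : s = 0.
  apply: (skew_poly_monic_mul (rmorph0 beta) (linear0 delta) skR (c := yS)
           (d := iS (v - a)) (b := yS ^+ n)).
  - exact: bij_inj.
  - by move=> b; apply: (skew_poly_mul0 (rmorph0 alpha) erefl skS).
  - by rewrite -sE yE rmorphXn.
have : yS ^+ n = 0.
  by apply: jR_inj; rewrite rmorphXn rmorph0 /= -yE sE s0 mulr0.
move=> yn0; have /polyP/(_ n)/eqP : 'X^n = 0 :> {poly A}.
  apply: (skew_horner_inj skS).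
  by rewrite rmorphXn /= map_polyX hornerXn yn0 rmorph0 horner0.
by rewrite coefXn eqxx coef0 oner_eq0.
Qed.

(** * The shifted Casimir element and reduction modulo it *)

Section Casimir.
Hypothesis u_central : forall a, u * a = a * u.
Context (lambda : K).

Let c := x * y - iota u - lambda%:A.

Lemma casimir_xy : x * y - iota (u + lambda%:A) = c.
Proof. by rewrite rmorphD /= linearZ /= rmorph1 opprD addrA. Qed.

Lemma casimir_yx : y * x - iota (alpha (u + lambda%:A)) = c.
Proof.
have -> : alpha (u + lambda%:A) = u + lambda%:A - v.
  by rewrite v_def opprB [RHS]addrC addrA subrK rmorphD /= linearZ /= rmorph1.
by rewrite -casimir_xy ambiskew_xy rmorphB /= opprB addrA.
Qed.

(** Of the two forms [x * y - w] and [y * x - alpha w], one is used on each side of the equation: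
    the products with [y], and likewise with [x], then agree. *)
Lemma casimir_central r : c * r = r * c.
Proof.
have Ciota a : GRing.comm c (iota a).
  rewrite /GRing.comm -casimir_xy mulrBl mulrBr -!rmorphM /= ; congr (_ - _).
    by rewrite -mulrA ambiskew_y_iota mulrA ambiskew_x_iota alphaK mulrA.
  by congr (iota _); rewrite mulrDl mulrDr u_central mulr_algl mulr_algr.
have Cy : GRing.comm c y.
  rewrite /GRing.comm -{2}casimir_xy -casimir_yx mulrBl mulrBr.
  by rewrite ambiskew_y_iota mulrA.
have Cx : GRing.comm c x.
  rewrite /GRing.comm -casimir_xy [in RHS]casimir_xy -casimir_yx mulrBl mulrBr.
  by rewrite ambiskew_x_iota alphaK mulrA.
elim/ambiskew_ind: r => [|r r' Hr Hr'|a i j].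
- exact: commr0.
- exact: commrD.
- by apply: commrM; [apply: commrM => //|]; apply: commrX.
Qed.

Lemma casimir_ideal : two_sided_ideal (principal_right c).
Proof.
split=> [|_ _ [s ->] [s' ->]|r _ [s ->]].
- by exists 0; rewrite mulr0.
- by exists (s + s'); rewrite mulrDr.
- split; last by exists (s * r); rewrite mulrA.
  by exists (r * s); rewrite mulrA -casimir_central mulrA.
Qed.

(** Basis of the generalized Weyl algebra over [A], graded by the integers; [Negz n] is [- n.+1],
    hence the exponent [n.+1]. *)
Definition signed_power (d : int) : R :=
  match d with Posz n => y ^+ n | Negz n => x ^+ n.+1 end.

Lemma casimir_normal_form r : exists l : seq (int * A),
  principal_right c (r - \sum_(k <- l) iota k.2 * signed_power k.1).
Proof.
have idI := casimir_ideal.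
have Ic : principal_right c c by exists 1; rewrite mulr1.
elim/ambiskew_ind: r => [|r r' [l Hl] [l' Hl']|a i j].
- by exists [::]; rewrite big_nil subr0; apply: tsi0.
- by exists (l ++ l'); rewrite big_cat opprD addrACA; apply: tsiD.
suff [d [b H]] : exists d b,
    principal_right c (iota a * y ^+ j * x ^+ i - iota b * signed_power d).
  by exists [:: (d, b)]; rewrite big_seq1.
elim: i j a => [|i IH] j a.
  by exists (Posz j), a; rewrite mulr1 subrr; apply: tsi0.
case: j => [|j]; first by exists (Negz i), a; rewrite mulr1 subrr; apply: tsi0.
pose w := alpha (u + lambda%:A).
(* The inner [y * x] is replaced by [w], which becomes [alpha^j(w)] when moved left past
   [y ^+ j]. *)
have [d [b Hb]] := IH j (a * iter j alpha w).
exists d, b; set m := iota b * _ in Hb *.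
have -> : iota a * y ^+ j.+1 * x ^+ i.+1 - m =
    iota a * y ^+ j * c * x ^+ i + (iota (a * iter j alpha w) * y ^+ j * x ^+ i - m).
  rewrite -casimir_yx -/w mulrBr mulrBl addrA exprSr exprS !mulrA.
  rewrite rmorphM /= -(mulrA (iota a) (iota _)).
  by rewrite -(skew_exp_iota ambiskew_y_iota) mulrA subrK.
exact: (tsiD idI (tsiMr idI _ (tsiMl idI _ Ic)) Hb).
Qed.

End Casimir.
End Ambiskew.

(** * A representation by shift matrices *)

Section ShiftRepresentation.
Context (K : fieldType) (A R C : algType K) (alpha alphaV : {lrmorphism A -> A}).
Hypothesis alphaVK : cancel alphaV alpha.
Context (u v : A) (v_def : v = u - alpha u).
Context (iota : {lrmorphism A -> R}) (y x : R).
Hypothesis R_ambiskew : is_ambiskew_poly_ring alpha alphaV v iota y x.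
Context (pi : {lrmorphism A -> C}) (mu : nat -> K).
Hypothesis pi_u : forall i, pi (iter i alpha u) = (mu i)%:A.
Context (n : nat) (lambda : K).
Hypotheses (mu0 : mu 0%N = - lambda) (mun : mu n.+1 = - lambda).

Let M := 'M[C]_n.+1.

Let mulE (P Q : M) : P * Q = P *m Q. Proof. by []. Qed.

Definition shift_diag (a : A) : M := diag_mx (\row_i pi (iter i alpha a)).
Definition shift_y : M := \matrix_(i, j) (j == i.+1 :> nat)%:R.
Definition shift_x : M :=
  \matrix_(i, j) ((i == j.+1 :> nat)%:R * (mu j.+1 + lambda))%:A.

Lemma iter_rmorphB i : zmod_morphism (iter i alpha).
Proof. by elim: i => [|i IH] a b //; rewrite !iterS IH rmorphB. Qed.

Lemma iter_rmorphM i : monoid_morphism (iter i alpha).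
Proof.
split; first by elim: i => //= i ->; rewrite rmorph1.
by elim: i => [|i IH] a b //; rewrite !iterS IH rmorphM.
Qed.

Lemma iter_scalar i (k : K) : iter i alpha k%:A = k%:A.
Proof. by elim: i => //= i ->; rewrite linearZ /= rmorph1. Qed.

Lemma shift_diagE a i j :
  shift_diag a i j = if i == j then pi (iter i alpha a) else 0.
Proof. by rewrite !mxE; case: eqVneq => [->|]. Qed.

Lemma shift_diagB : zmod_morphism shift_diag.
Proof.
move=> a b; apply/matrixP => i j; rewrite !(shift_diagE, mxE).
by case: eqP => _; rewrite ?subr0 // iter_rmorphB rmorphB.
Qed.

Lemma shift_diagM : monoid_morphism shift_diag.
Proof.
split=> [|a b]; apply/matrixP => i j.
  by rewrite shift_diagE (iter_rmorphM i).1 rmorph1 mxE; case: eqP.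
rewrite shift_diagE mulE mul_diag_mx !mxE.
case: eqVneq => [->|_]; last by rewrite mulr0n mulr0.
by rewrite (iter_rmorphM j).2 rmorphM.
Qed.

Definition shift_diag_zmod :=
  GRing.isZmodMorphism.Build A M shift_diag shift_diagB.
Definition shift_diag_monoid :=
  GRing.isMonoidMorphism.Build A M shift_diag shift_diagM.
Definition shift_diag_rmorphism : {rmorphism A -> M} :=
  HB.pack shift_diag shift_diag_zmod shift_diag_monoid.

(** Diagonal entry [i] is [mu i + lambda]. In row [0] the product has nothing to contribute, which
    is consistent because [mu 0 = - lambda]. *)
Lemma shift_xy : shift_x * shift_y = shift_diag u + lambda%:A%:M.
Proof.
apply/matrixP => i k; rewrite mxE [RHS]mxE shift_diagE pi_u !mxE.
under eq_bigr do rewrite !mxE.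
case: i => [[|i] ip] /=.
  rewrite big1 => [|j _]; last by rewrite mul0r scale0r mul0r.
  case: eqP => _; last by rewrite addr0.
  by rewrite mulr1n mu0 scaleNr addNr.
rewrite (bigD1 (Ordinal (ltnW ip : (i < n.+1)%N))) //= big1 => [|j jn].
  rewrite eqxx mul1r addr0 [k == _ :> nat]eq_sym -val_eqE /=.
  case: eqP => _; last by rewrite mulr0 addr0.
  by rewrite mulr1 mulr1n scalerDl.
rewrite eqSS [i == _]eq_sym.
by move: jn; rewrite -val_eqE /= => /negbTE->; rewrite mul0r scale0r mul0r.
Qed.

(** Here the shift moves the diagonal to [mu i.+1 + lambda], and the empty last row is consistent
    because [mu n.+1 = - lambda]. *)
Lemma shift_yx : shift_y * shift_x = shift_diag (alpha u) + lambda%:A%:M.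
Proof.
apply/matrixP => i k; rewrite mxE [RHS]mxE shift_diagE -iterSr pi_u !mxE.
under eq_bigr do rewrite !mxE.
have [ip | ip] := ltnP i.+1 n.+1; last first.
  have -> : i.+1 = n.+1 by apply/eqP; rewrite eqn_leq ip andbT ltn_ord.
  rewrite big1 => [|j _]; last by rewrite ltn_eqF ?mul0r.
  case: eqP => _; last by rewrite addr0.
  by rewrite mulr1n mun scaleNr addNr.
rewrite (bigD1 (Ordinal ip)) //= big1 => [|j jn].
  rewrite eqxx mul1r addr0 eqSS -val_eqE /=.
  case: eqP => [->|_]; last by rewrite mul0r scale0r addr0.
  by rewrite mul1r mulr1n scalerDl.
by move: jn; rewrite -val_eqE /= => /negbTE->; rewrite mul0r.
Qed.

Lemma shift_y_diag a : shift_y * shift_diag a = shift_diag (alpha a) * shift_y.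
Proof.
rewrite !mulE mul_mx_diag mul_diag_mx; apply/matrixP=> i j.
rewrite !mxE; case: eqP => [->|_]; last by rewrite mul0r mulr0.
by rewrite mul1r mulr1 iterSr.
Qed.

Lemma shift_x_diag a : shift_x * shift_diag a = shift_diag (alphaV a) * shift_x.
Proof.
rewrite !mulE mul_mx_diag mul_diag_mx; apply/matrixP=> i j.
rewrite !mxE; case: eqP => [->|_]; last by rewrite mul0r scale0r mul0r mulr0.
by rewrite iterSr alphaVK mulr_algl mulr_algr.
Qed.

Lemma shift_y_exp k : shift_y ^+ k = \matrix_(i, j) (j == (i + k)%N :> nat)%:R.
Proof.
elim: k => [|k IH]; apply/matrixP => i j.
  by rewrite !mxE addn0 -val_eqE /= [j == _ :> nat]eq_sym.
rewrite exprS IH !mxE; under eq_bigr do rewrite !mxE.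
have [ip | ip] := ltnP i.+1 n.+1.
  rewrite (bigD1 (Ordinal ip)) //= big1 => [|l ln].
    by rewrite eqxx mul1r addr0 addnS addSn.
  by move: ln; rewrite -val_eqE /= => /negbTE->; rewrite mul0r.
rewrite big1 => [|l _]; last by rewrite ltn_eqF ?mul0r // (leq_trans (ltn_ord l)).
rewrite ltn_eqF // (leq_trans (ltn_ord j)) // (leq_trans ip) // addnS ltnS.
exact: leq_addr.
Qed.

(** The morphism is built by two liftings, first to [A[y; alpha]], then to [R]. The power of
    [shift_y] vanishes because the shift leaves the matrix. *)
Lemma shift_representation : exists f : {rmorphism R -> M},
  f (x * y - iota u - lambda%:A) = 0 /\ f (y ^+ n.+1) = 0.
Proof.
case: R_ambiskew => S [iS [jR [yS [beta [delta
  [[skS skR iE yE] [_ bS by_] [dD dS dy]]]]]]].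
have [g [gS gy]] : exists g : {rmorphism S -> M},
    (forall a, g (iS a) = shift_diag_rmorphism a) /\ g yS = shift_y.
  apply: (skew_poly_lift (rmorph0 alpha) erefl skS) => a.
  by rewrite rmorph0 addr0; apply: shift_y_diag.
(* The compatibility needed for the second lifting; it passes to products because [delta] is a skew
   derivation, so generators suffice. *)
pose D b := shift_x * g b = g (beta b) * shift_x + g (delta b).
have DM b b' : D b -> D b' -> D (b * b').
  rewrite /D => Db Db'; rewrite rmorphM mulrA Db mulrDl -mulrA Db' dD.
  rewrite !rmorphM rmorphD !rmorphM.
  by rewrite mulrDr !mulrA addrA.
have D_iS a : D (iS a).
  by rewrite /D bS dS !gS rmorph0 addr0; apply: shift_x_diag.
have D_y : D yS.
  rewrite /D by_ dy gS gy shift_xy shift_yx addrAC; congr (_ + _).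
  by rewrite v_def [shift_diag_rmorphism _]shift_diagB addrC subrK.
have Dall b : D b.
  elim/(skew_poly_ind skS): b => [|b b' Db Db'|a i].
  - by rewrite /D !(rmorph0, linear0) mulr0 mul0r addr0.
  - rewrite /D rmorphD mulrDr Db Db' !(rmorphD, linearD) /= mulrDl.
    by rewrite addrACA.
  apply: (DM _ _ (D_iS a)); elim: i => [|i IH].
    by rewrite expr0 -(rmorph1 iS); apply: D_iS.
  by rewrite exprS; apply: (DM _ _ D_y IH).
have [f [fS fx]] := skew_poly_lift (rmorph0 beta) (linear0 delta) skR Dall.
have fiota a : f (iota a) = shift_diag a by rewrite iE fS gS.
have fy : f y = shift_y by rewrite yE fS.
exists f; split; last first.
  rewrite rmorphXn /= fy shift_y_exp; apply/matrixP => i j; rewrite !mxE.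
  by rewrite ltn_eqF // (leq_trans (ltn_ord j)) ?leq_addl.
have -> : lambda%:A = iota lambda%:A by rewrite linearZ /= rmorph1.
rewrite !rmorphB rmorphM /= fx fy !fiota shift_xy [shift_diag u + _]addrC addrK.
have -> : shift_diag lambda%:A = lambda%:A%:M.
  apply/matrixP => i j; rewrite shift_diagE iter_scalar linearZ /= rmorph1 mxE.
  by case: eqP.
by rewrite subrr.
Qed.

End ShiftRepresentation.

(** * The maximality criterion *)

(** For [p = 2k + 1] the exponent is [k + 1 - m], so both sides equal [q ^+ k.+1], the product of
    the two coefficients of [u]. *)
Lemma half_exponent_sqr (K : fieldType) (q r : K) (p m : nat) :
  q != 0 -> r ^+ 2 = q -> odd p ->
  (r ^ ((p%:Z - 2 * m%:Z + 1) %/ 2)%Z) ^+ 2 * q ^+ m = q ^+ (p.-1)./2 * q.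
Proof.
move=> q0 rq p_odd; have r0 : r != 0.
  by apply: contraNneq q0 => r0; rewrite -rq r0 expr0n.
have [k ->] : exists k, p = k.*2.+1.
  by exists p./2; rewrite -{1}(odd_double_half p) p_odd.
have -> : (((k.*2.+1)%:Z - 2 * m%:Z + 1) %/ 2)%Z = k.+1%:Z - m%:Z by lia.
rewrite /= doubleK -exprSr -rq -!exprM (exprnP _ 2) (exprnP _ (2 * m)).
rewrite (exprnP _ (2 * _)) exprz_exp -expfzDr //; congr (r ^ _); lia.
Qed.

Lemma exprz_inj (K : fieldType) (q : K) : q != 0 ->
  (forall n, (0 < n)%N -> q ^+ n != 1) -> injective (exprz q).
Proof.
move=> q0 q_inf.
have wlog_inj (a b : int) : a <= b -> q ^ a = q ^ b -> a = b.
  move=> ab qab; have q1 : q ^ (b - a) = 1.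
    by rewrite expfzDr // -qab -expfzDr // subrr.
  have [n nE] : exists n : nat, b - a = n by exists `|b - a|%N; lia.
  move: q1; rewrite nE; case: n nE => [|n] nE; first by move=> _; lia.
  by move/eqP; rewrite (negbTE (q_inf n.+1 _)).
move=> a b qab; have [ab | ba] : (a <= b) \/ (b <= a) by lia.
  exact: wlog_inj.
by apply/esym/wlog_inj.
Qed.

(** * The central generator *)

Section LastGenerator.
Context (K : fieldType) (q : K) (p' : nat) (A : algType K).
Context (z zV : nat -> A).
Hypotheses (q_neq0 : q != 0) (p'_even : ~~ odd p').
Hypothesis torusA : is_quantum_torus p'.+1 (torus_coef q) z zV.

Let rel : quantum_torus_relations p'.+1 (torus_coef q) z zV.
Proof. by case: torusA. Qed.

(** The last index [p'] is even and no index is larger, so its form with every other index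
    vanishes. *)
Lemma last_gen_central a : z p'.+1 * a = a * z p'.+1.
Proof.
have form0 j : (j < p'.+1)%N -> torus_form p' j = 0.
  by rewrite ltnS => jp; rewrite /torus_form (negbTE p'_even) ltnNge jp andbF.
have commV (g gV b : A) :
    g * gV = 1 -> gV * g = 1 -> b * g = g * b -> b * gV = gV * b.
  move=> gK gVK bg.
  by rewrite -[b in LHS]mul1r -gVK -!mulrA (mulrA g) -bg -(mulrA b) gK mulr1.
elim/(torus_ind torusA): a => [|k a b Ha Hb|a b Ha Hb|[//|i] ip].
- by rewrite mulr1 mul1r.
- by rewrite mulrDr mulrDl -scalerAr -scalerAl Ha Hb.
- by rewrite mulrA Ha -mulrA Hb mulrA.
have zi : z p'.+1 * z i.+1 = z i.+1 * z p'.+1.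
  by have := qcomm_gen q_neq0 rel (ltnSn p') ip; rewrite form0 // /qcomm scale1r.
by split=> //; apply: (commV (z i.+1)); rewrite ?(gen_mulV rel) ?(gen_mulVl rel).
Qed.

Lemma last_genV_central a : zV p'.+1 * a = a * zV p'.+1.
Proof.
rewrite -[a in LHS]mulr1 -(gen_mulV rel (ltnSn p')) (mulrA a) -last_gen_central.
by rewrite !mulrA (gen_mulVl rel) // mul1r.
Qed.

(** All relations of the last generator are commutations, so they persist when it is replaced by a
    scalar. *)
Lemma last_gen_specialize (c : K) : c != 0 -> exists f : {lrmorphism A -> A},
  f (z p'.+1) = c%:A /\ f (zV p'.+1) = c^-1%:A.
Proof.
move=> c0; case: torusA => _ lift _.
pose b i := if i == p'.+1 then c%:A else z i.
pose bV i := if i == p'.+1 then c^-1%:A else zV i.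
have [f fE] : exists f : {lrmorphism A -> A},
    forall i, (1 <= i <= p'.+1)%N -> f (z i) = b i /\ f (zV i) = bV i.
  apply: lift; split=> [i ip | i j j1 ji ip].
    rewrite /b /bV; case: ifP => _; last exact: rel.1.
    by rewrite mulr_algl mulr_algl !scalerA mulfV ?mulVf // scale1r.
  rewrite /b; have -> : (j == p'.+1) = false by rewrite ltn_eqF // (leq_trans ji).
  have [-> | _] := eqVneq; last exact: rel.2.
  by rewrite /torus_coef /= negbK (negbTE p'_even) scale1r mulr_algl mulr_algr.
by exists f; rewrite !(fE p'.+1 (leqnn _)).1 !(fE p'.+1 (leqnn _)).2 /b /bV eqxx.
Qed.

End LastGenerator.

(** * The two directions of the criterion *)

Section Criterion.
Context (K : fieldType) (q : K) (q_neq0 : q != 0).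
Hypothesis q_inf : forall n : nat, (0 < n)%N -> q ^+ n != 1.
Context (p' : nat) (p'_even : ~~ odd p').
Context (A R : algType K) (z zV : nat -> A).
Hypothesis torusA : is_quantum_torus p'.+1 (torus_coef q) z zV.
Context (alpha alphaV : {lrmorphism A -> A}).
Hypotheses (alphaK : cancel alpha alphaV) (alphaVK : cancel alphaV alpha).
Hypothesis alpha_gen : forall i, (i < p'.+1)%N ->
  alpha (z i.+1) = (if odd i then 1 else q^-1) *: z i.+1.
Context (s : K) (v : A).

Let Z := z p'.+1.
Let ZV := zV p'.+1.
Let u := s *: ZV + q *: Z.

Hypothesis v_def : v = u - alpha u.
Context (iota : {lrmorphism A -> R}) (y x : R).
Hypothesis R_ambiskew : is_ambiskew_poly_ring alpha alphaV v iota y x.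
Context (lambda : K).

Let rel : quantum_torus_relations p'.+1 (torus_coef q) z zV.
Proof. by case: torusA. Qed.

Let c := x * y - iota u - lambda%:A.
Let I : R -> Prop := principal_right c.

Let u_central a : u * a = a * u.
Proof.
rewrite /u mulrDl mulrDr -!scalerAl -!scalerAr.
by rewrite (last_gen_central q_neq0 p'_even torusA)
           (last_genV_central q_neq0 p'_even torusA).
Qed.

Lemma casimir_not_maximal (nu : K) (n : nat) :
  nu != 0 -> nu ^+ 2 * q ^+ n.+1 = s * q -> lambda = nu * (q ^+ n.+1 + 1) ->
  ~ maximal_ideal I.
Proof.
move=> nu0 nuE lE [_ _ maxI].
have qn0 : q ^+ n != 0 by rewrite expf_neq0.
have sE : s = nu ^+ 2 * q ^+ n.
  by apply: (mulIf q_neq0); rewrite -nuE [q ^+ _]exprSr mulrA.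
(* This scalar is the common root of [u + lambda] and its image under [alpha^(n+1)]: that power of
   [alpha] swaps the values of the two terms of [u] there. *)
have c0 : - nu * q ^+ n != 0 by rewrite mulf_neq0 ?oppr_eq0.
have [f [fZ fZV]] := last_gen_specialize p'_even torusA c0.
pose mu i :=
  s * (q^-1 ^+ i)^-1 * (- nu * q ^+ n)^-1 + q * q^-1 ^+ i * (- nu * q ^+ n).
have f_u i : f (iter i alpha u) = (mu i)%:A.
  have -> : u = laurent Z ZV s q 0 by rewrite /laurent scale0r addr0.
  rewrite (iter_tau_laurent torusA _ alpha_gen) ?invr_neq0 // /laurent scale0r addr0.
  by rewrite linearD !linearZ /= fZ fZV !scalerA -scalerDl.
have mu0 : mu 0%N = - lambda.
  rewrite /mu lE sE expr0 invr1 !mulr1 [q ^+ n.+1]exprS.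
  by field; rewrite qn0 oppr_eq0; apply: nu0.
have mun : mu n.+1 = - lambda.
  rewrite /mu lE sE exprVn invrK [q ^+ n.+1]exprS.
  by field; rewrite qn0 q_neq0 oppr_eq0; apply: nu0.
have [F [Fc Fy]] :=
  shift_representation alphaVK v_def R_ambiskew f_u mu0 mun.
have idJ : two_sided_ideal (fun r => F r = 0).
  split=> [|a b Fa Fb|r a Fa]; first exact: rmorph0.
    by rewrite rmorphD Fa Fb addr0.
  by rewrite !rmorphM Fa mulr0 mul0r.
case: (maxI _ idJ) => [_ [b ->]|JI|/(_ 1)].
- by rewrite rmorphM Fc mul0r.
- apply: (ambiskew_monic_ndvd (a := u + lambda%:A) (n := n.+1) alphaK R_ambiskew).
  by rewrite casimir_xy; apply: JI.
by rewrite rmorph1 => /eqP; rewrite oner_eq0.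
Qed.

Let alphaV_gen i : (i < p'.+1)%N ->
  alphaV (z i.+1) = (if odd i then 1 else q) *: z i.+1.
Proof.
move=> ip; apply: (can_inj alphaK); rewrite alphaVK linearZ /= alpha_gen // scalerA.
by case: (odd i); rewrite ?mulr1 ?mulfV // scale1r.
Qed.

(** The coefficient commutes with the central [Z], so the eigenvalue depends on the degree [d]
    only. *)
Let conj_signed_power d a :
  iota ZV * (iota a * signed_power y x d) * iota Z =
  q ^ (- d) *: (iota a * signed_power y x d).
Proof.
suff TZ : signed_power y x d * iota Z = q ^ (- d) *: (iota Z * signed_power y x d).
  rewrite -!mulrA TZ -!scalerAr; congr (_ *: _); rewrite !mulrA -!rmorphM /=.
  congr (iota _ * _).
  rewrite -mulrA -(last_gen_central q_neq0 p'_even torusA) mulrA.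
  by rewrite (gen_mulVl rel) // mul1r.
case: d => n /=.
  rewrite (skew_exp_iota (ambiskew_y_iota R_ambiskew)) (iter_tau_gen alpha_gen) //.
  by rewrite (negbTE p'_even) linearZ /= -scalerAl exprVn exprnN.
rewrite (skew_exp_iota (ambiskew_x_iota R_ambiskew)) (iter_tau_gen alphaV_gen) //.
by rewrite (negbTE p'_even) linearZ /= -scalerAl.
Qed.

Lemma casimir_maximal :
  (forall m, (0 < m)%N -> lambda ^+ 2 * q ^+ m != s * q * (q ^+ m + 1) ^+ 2) ->
  maximal_ideal I.
Proof.
move=> res.
have idI : two_sided_ideal I.
  exact: (casimir_ideal alphaK v_def R_ambiskew u_central lambda).
have Ic : I c by exists 1; rewrite mulr1.
split=> // [|J idJ IJ].
  (* Properness is the case [n = 0] of [ambiskew_monic_ndvd]. *)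
  rewrite -(expr0 y) /I /c -(casimir_xy u iota y x lambda).
  exact: (ambiskew_monic_ndvd alphaK R_ambiskew).
have [JI | /existsNP[r /not_implyP[Jr Ir]]] :=
  pselect (forall r, J r -> I r); first by left.
right; suff J1 : J 1 by move=> r'; rewrite -[r']mulr1; apply: tsiMl.
have [l Il] := casimir_normal_form alphaK v_def R_ambiskew u_central lambda r.
rewrite (@big_collect _ _ _ (fun d a => iota a * signed_power y x d)) in Il; last 2 first.
- by move=> d; rewrite rmorph0 mul0r.
- by move=> d a b; rewrite rmorphD mulrDl.
set ds := undup _ in Il; set a := (fun d => \sum_(k <- l | k.1 == d) k.2).
pose T d := iota (a d) * signed_power y x d.
have {}Jr : J (\sum_(d <- ds) T d) by apply: ((tsi_congr idJ (IJ _ Il)).1 Jr).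
have {}Ir : ~ I (\sum_(d <- ds) T d) by move=> /(tsi_congr idI Il).2.
have q_inj := exprz_inj q_neq0 q_inf.
have qV_inj : injective (exprz q^-1).
  by move=> i j; rewrite !exprz_inv => /q_inj/oppr_inj.
have JT := tsi_homogeneous idJ (fun d => conj_signed_power d (a d))
  (inj_comp q_inj oppr_inj) (undup_uniq _) Jr.
(* All components lie in [J]; one of them is outside [I], so its coefficient is nonzero. *)
have [d dds ITd] : exists2 d, d \in ds & ~ I (T d).
  apply: contrapT => noT; apply: Ir; apply: tsi_sum => // d dds.
  by apply: contrapT => ITd; apply: noT; exists d.
have ad0 : a d != 0.
  by apply/eqP => ad0; apply: ITd; rewrite /T ad0 rmorph0 mul0r; apply: tsi0.
have Jxy : J (x * y - iota (u + lambda%:A)) by rewrite casimir_xy; apply: IJ.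
have Jyx : J (y * x - iota (alpha (u + lambda%:A))).
  by rewrite (casimir_yx v_def R_ambiskew); apply: IJ.
have p_odd : odd p'.+1 by [].
have qV0 : q^-1 != 0 by rewrite invr_eq0.
have := JT d dds; rewrite /T; case: d {dds ITd} ad0 => n ad0 /=.
  case/(tsi_reduce_to_power q_neq0 p_odd torusA qV0 alpha_gen q_inj qV_inj
    (ambiskew_y_iota R_ambiskew) idJ ad0) => n'.
  apply: (tsi_power_descent torusA qV0 alpha_gen qV_inj (ambiskew_y_iota R_ambiskew)
    idJ (ltnSn p') p'_even Jxy Jyx) => k k0.
  (* The condition for [q^-1 ^+ k] becomes the one for [q ^+ k] after multiplication by
     [q ^+ k ^+ 2]. *)
  apply: contra (res k k0) => /eqP E.
  have qk0 : q ^+ k != 0 by rewrite expf_neq0.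
  apply/eqP; transitivity (lambda ^+ 2 * q^-1 ^+ k * q ^+ k ^+ 2).
    by rewrite exprVn; field.
  by rewrite E exprVn; field.
case/(tsi_reduce_to_power q_neq0 p_odd torusA q_neq0 alphaV_gen q_inj q_inj
  (ambiskew_x_iota R_ambiskew) idJ ad0) => n'.
(* For negative degrees the roles of [x] and [y] are exchanged, and [alpha (u + lambda)] takes the
   place of [w]; its outer coefficients have the same product [s * q]. *)
have alphaL : alpha (u + lambda%:A) =
    laurent Z ZV (s * (q^-1 ^+ 1)^-1) (q * q^-1 ^+ 1) lambda.
  exact: (iter_tau_laurent torusA qV0 alpha_gen 1 s q lambda (ltnSn p') p'_even).
apply: (tsi_power_descent torusA q_neq0 alphaV_gen q_inj (ambiskew_x_iota R_ambiskew)
    idJ (ltnSn p') p'_even (t' := y)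
    (s := s * (q^-1 ^+ 1)^-1) (b := q * q^-1 ^+ 1) (l := lambda)).
- by rewrite -/Z -/ZV -alphaL.
- by rewrite -/Z -/ZV -alphaL alphaK.
move=> k k0; have := res k k0; congr (_ != _ * _).
by rewrite !expr1 invrK mulfV // mulr1.
Qed.

End Criterion.

Theorem corollary3p6
  (K : closedFieldType) (p : nat) (p_odd : odd p)
  (q : K) (q_neq0 : q != 0)
  (q_not_root_of_unity : forall n : nat, (0 < n)%N -> q ^+ n != 1)
  (* r is the chosen square root of q *)
  (r : K) (r_sqrt : r ^+ 2 = q)
  (A : algType K) (z zV : nat -> A)
  (A_torus : is_quantum_torus p (torus_coef q) z zV)
  (alpha alphaV : {lrmorphism A -> A})
  (alphaK : cancel alpha alphaV) (alphaVK : cancel alphaV alpha)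
  (alpha_even : forall i, (1 <= i <= p)%N -> ~~ odd i -> alpha (z i) = z i)
  (alpha_odd : forall i, (1 <= i <= p)%N -> odd i ->
     alpha (z i) = q^-1 *: z i)
  (u v : A) (u_def : u = torus_u p q z zV) (v_def : v = u - alpha u)
  (R : algType K) (iota : {lrmorphism A -> R}) (y x : R)
  (R_ambiskew : is_ambiskew_poly_ring alpha alphaV v iota y x)
  (casimir : R) (casimir_def : casimir = x * y - iota u)
  (lambda : K) :
  maximal_ideal (principal_right (casimir - lambda%:A)) <->
  (forall m : nat, (1 <= m)%N ->
     let c := r ^ ((p%:Z - 2 * m%:Z + 1) %/ 2)%Z * (q ^+ m + 1) in
     lambda <> c /\ lambda <> - c).
Proof.
case: p p_odd A_torus alpha_even alpha_odd u_def => // p' p'_even torusA.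
move=> alpha_even alpha_odd; rewrite /torus_u => uE; subst u casimir.
have alpha_gen i : (i < p'.+1)%N ->
    alpha (z i.+1) = (if odd i then 1 else q^-1) *: z i.+1.
  move=> ip; case: ifP => io; last by rewrite alpha_odd //= io.
  by rewrite alpha_even ?scale1r //= io.
pose nu m := r ^ ((p'.+1%:Z - 2 * m%:Z + 1) %/ 2)%Z.
have nuE m : nu m ^+ 2 * q ^+ m = q ^+ p'./2 * q by apply: half_exponent_sqr.
split=> [maxI m m1 | good]; last first.
  apply: (casimir_maximal q_neq0 q_not_root_of_unity p'_even torusA alphaK alphaVK
    alpha_gen     v_def R_ambiskew) => m m1.
  have [/eqP lc /eqP lcN] := good m m1; apply: contra_neqN lc => /eqP E.
  (* A common root makes [lambda] agree with one of the two excluded values up to sign, by comparing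
     squares. *)
  have : lambda ^+ 2 == (nu m * (q ^+ m + 1)) ^+ 2.
    apply/eqP/(mulIf (expf_neq0 m q_neq0)).
    by rewrite E -(nuE m); ring.
  by rewrite eqf_sqr (negbTE lcN) orbF => /eqP.
have nu0 : nu m != 0.
  apply/eqP => nu0; have := nuE m; rewrite nu0 expr0n mul0r => /esym/eqP.
  by rewrite mulf_eq0 expf_eq0 (negbTE q_neq0) andbF.
(* The negative sign is obtained from [- nu], which has the same square. *)
rewrite -/(nu m); case: m m1 nu0 => // n _ nu0; split=> lE; move: maxI;
  [apply: (@casimir_not_maximal K q q_neq0 p' p'_even A R z zV torusA alpha
      alphaV alphaK alphaVK alpha_gen _ v v_def iota y x R_ambiskew lambda (nu n.+1) n)
  |apply: (@casimir_not_maximal K q q_neq0 p' p'_even A R z zV torusA alpha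
      alphaV alphaK alphaVK alpha_gen _ v v_def iota y x R_ambiskew lambda (- nu n.+1) n)];
  rewrite ?oppr_eq0 ?sqrrN //.
by rewrite lE mulNr.
Qed.
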